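(* Let $N>1$ and let $C$ be a clusteron of size $N$ occupying at least two rooms, other than the clusterons $12$ and $21$. Then every final state reachable from $C$ has at most one violinist per room, and the set of shadows of final states reachable from $C$ is exactly $\mathcal{F}_N$.
   Context: Rooms are indexed by the integers, room $i$ being adjacent to rooms $i-1$ and $i+1$. A state is a placement of finitely many indistinguishable violinists in rooms, several violinists being allowed in one room: a function $a:\mathbb{Z}\to\mathbb{Z}_{\ge0}$ with finite support, $a_i$ the number of violinists in room $i$; its size is $N=\sum_i a_i$. Room $i$ is occupied if $a_i\ge1$. A move is possible whenever two adjacent rooms $i,i+1$ are both occupied: one violinist leaves room $i$ and goes to the nearest unoccupied room to the left of $i$ (the largest $j<i$ with $a_j=0$), and one violinist leaves room $i+1$ and goes to the nearest unoccupied room to the right of $i+1$ (the smallest $j>i+1$ with $a_j=0$). A state is final if no move is possible. A state is reachable from $S$ if it is obtained from $S$ by a finite (possibly empty) sequence of moves. A clusteron is a state whose occupied rooms form a nonempty set of consecutive rooms; it is written as the word of occupation numbers from left to right (e.g. $12$ means two adjacent rooms containing $1$ and $2$ violinists, in that order). For a state with at most one violinist per room, its shadow is the $0/1$ word recording the occupancy of rooms from its leftmost to its rightmost occupied room. For $N\ge2$ and $1\le k\le N-1$, $F_{N,k}$ denotes the shadow with $N$ ones in which consecutive ones are separated by a single $0$, except that the $k$-th and $(k+1)$-st ones are separated by $00$ (e.g. $F_{3,2}=101001$), and $\mathcal{F}_N=\{F_{N,k}:1\le k\le N-1\}$. *)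

(* Defs.v *)
From Stdlib Require Export Relation_Operators.
From HB Require Export structures.
From mathcomp Require Export all_boot all_order all_algebra finmap.

Set Implicit Arguments.
Unset Strict Implicit.
Unset Printing Implicit Defensive.

Import Order.TTheory GRing.Theory Num.Theory.

Local Open Scope ring_scope.

Definition state := {fsfun int -> nat with 0%N}.

Definition state_size (a : state) : nat := (\sum_(i <- finsupp a) a i)%N.

Definition occupied (a : state) (i : int) : bool := (1 <= a i)%N.

Definition nearest_free_left (a : state) (i l : int) : Prop :=
  [/\ l < i, a l = 0%N & forall j : int, j < i -> a j = 0%N -> j <= l].

Definition nearest_free_right (a : state) (i r : int) : Prop :=
  [/\ i < r, a r = 0%N & forall j : int, i < j -> a j = 0%N -> r <= j].

(* The truncated subtraction is exact: rooms i and i + 1 are occupied. *)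
Definition move (a b : state) : Prop :=
  exists i l r : int,
    [/\ occupied a i, occupied a (i + 1),
        nearest_free_left a i l, nearest_free_right a (i + 1) r
      & forall j : int,
          b j = (a j - ((j == i) || (j == i + 1)%R) + ((j == l) || (j == r)))%N].

Definition final (a : state) : Prop := ~ exists b : state, move a b.

Definition reachable : state -> state -> Prop := clos_refl_trans state move.

Definition clusteron (a : state) : Prop :=
  exists (m : int) (n : nat),
    (0 < n)%N /\ forall i : int, occupied a i = (m <= i < m + n%:Z).

Definition leftmost (a : state) (l : int) : Prop :=
  occupied a l /\ forall i : int, occupied a i -> l <= i.

Definition rightmost (a : state) (r : int) : Prop :=
  occupied a r /\ forall i : int, occupied a i -> i <= r.

Definition rooms (l r : int) : seq int :=
  [seq l + k%:Z | k <- iota 0 `|r - l|%N.+1].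

Definition has_word (a : state) (w : seq nat) : Prop :=
  exists l r : int,
    [/\ leftmost a l, rightmost a r & w = [seq a i | i <- rooms l r]].

Definition at_most_one_per_room (a : state) : Prop :=
  forall i : int, (a i <= 1)%N.

(* Only meaningful for states with at most one violinist per room;
   the digits 1 and 0 are rendered as true and false. *)
Definition has_shadow (a : state) (w : seq bool) : Prop :=
  exists l r : int,
    [/\ leftmost a l, rightmost a r & w = [seq occupied a i | i <- rooms l r]].

(* The index j runs over the gaps, gap j lying between the j-th and the
   (j+1)-st ones. *)
Definition Fword (N k : nat) : seq bool :=
  true :: flatten [seq (if j == k then [:: false; false; true]
                        else [:: false; true]) | j <- iota 1 N.-1].

Definition Ffamily (N : nat) (w : seq bool) : Prop :=
  exists k : nat, (1 <= k <= N - 1)%N /\ w = Fword N k.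

(* Main.v *)
Require Import Defs.
From mathcomp Require Import zify.

(** A state is coded by the word of its occupation numbers on a large enough
    window, and a move rewrites [0 X (c+1) (d+1) Y 0] into [1 X c d Y 1], where
    [X] and [Y] have no zero.

    Three properties survive every move: a room with two violinists has an
    occupied neighbour; between two internal gaps [00] there is a pair of
    adjacent occupied rooms; there is such a pair or an internal gap [00]. In a
    final state no two adjacent rooms are occupied, so it has one violinist per
    room and exactly one gap [00].

    Conversely, all shadows are reached by induction on the size. One violinist
    standing to the left of a clusteron [D] can be left out of every move: it
    is pushed along when [D] expands, and when [D] has ended in [F_{N-1,k}] with
    that violinist next to it, the pair [11] travels right and yields [F_{N,k}].
    Symmetrically, a violinist to the right of [D] yields [F_{N,k+1}]. It
    remains to detach such a violinist from each clusteron within at most two moves at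
    each end; the clusterons [1x], [x1], [1...12], [21...1], where one end only
    gives a violinist two rooms away from [D], and [112], [121], [211] are
    treated apart. *)

Set Implicit Arguments.
Unset Strict Implicit.
Unset Printing Implicit Defensive.

Local Open Scope nat_scope.

(** * Rewriting words *)

Inductive step : seq nat -> seq nat -> Prop :=
  Step A X c d Y B of all (leq 1) X & all (leq 1) Y :
    step (A ++ 0 :: X ++ c.+1 :: d.+1 :: Y ++ 0 :: B)
         (A ++ 1 :: X ++ c :: d :: Y ++ 1 :: B).

Notation reach := (clos_refl_trans (seq nat) step).
Notation zeros := (nseq^~ 0).

Lemma cat_assoc (T : Type) (u v w : seq T) : (u ++ v) ++ w = u ++ v ++ w.
Proof. by rewrite catA. Qed.

Definition catE := (cat_cons, cat0s, cat_assoc).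

Lemma reach_trans u v w : reach u v -> reach v w -> reach u w.
Proof. exact: rt_trans. Qed.

Lemma fire A X c d Y B w w' :
    all (leq 1) X -> all (leq 1) Y ->
    w = A ++ 0 :: X ++ c.+1 :: d.+1 :: Y ++ 0 :: B ->
    w' = A ++ 1 :: X ++ c :: d :: Y ++ 1 :: B ->
  reach w w'.
Proof. by move=> hX hY -> ->; apply: rt_step; apply: Step. Qed.

Lemma reach_homo (f : seq nat -> seq nat) :
    (forall u v, step u v -> step (f u) (f v)) ->
  forall u v, reach u v -> reach (f u) (f v).
Proof.
move=> hf u v; elim=> [x y /hf|x|x y z _ h1 _ h2]; first exact: rt_step.
  exact: rt_refl.
exact: reach_trans h1 h2.
Qed.

Lemma step_ctx U V u v : step u v -> step (U ++ u ++ V) (U ++ v ++ V).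
Proof.
case=> A X c d Y B hX hY.
have := Step (U ++ A) c d (B ++ V) hX hY.
by rewrite !catE.
Qed.

Lemma reach_ctx U V u v : reach u v -> reach (U ++ u ++ V) (U ++ v ++ V).
Proof. exact: (@reach_homo (fun u => U ++ u ++ V) (@step_ctx U V)). Qed.

Lemma step_rev u v : step u v -> step (rev u) (rev v).
Proof.
case=> A X c d Y B hX hY.
have := @Step (rev B) (rev Y) d c (rev X) (rev A).
rewrite !all_rev => /(_ hY hX).
by rewrite !(rev_cat, rev_cons) -!cats1 !catE.
Qed.

Lemma reach_rev u v : reach u v -> reach (rev u) (rev v).
Proof. exact: reach_homo step_rev u v. Qed.

(* A violinist that does not take part in the moves of [w]: it waits in room
   [p] of [0 :: w] and, once the leftmost violinist of [w] gets next to it, is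
   pushed along. *)
Fixpoint add_left (p : nat) (w : seq nat) : seq nat :=
  match p, w with
  | p'.+1, 0 :: w' => 0 :: add_left p' w'
  | _, _ => 1 :: w
  end.

Lemma add_left_zeros p i w :
  add_left (i + p) (zeros i ++ w) = zeros i ++ add_left p w.
Proof. by elim: i => //= i ->. Qed.

Lemma add_left0 w : add_left 0 w = 1 :: w.
Proof. by case: w. Qed.

Lemma add_left_pos p x w : 0 < x -> add_left p (x :: w) = 1 :: x :: w.
Proof. by case: x => // x; case: p. Qed.

(** When the extra violinist stands right in front of [X], it lengthens [X] by one and the move
    fills the room before it; otherwise it belongs to [A]. *)
Lemma step_add_left p u v : step u v -> step (add_left p u) (add_left p v).
Proof.
case=> A X c d Y B hX hY; elim: A p => [|a A IH] p.
  case: p => [|p] /=.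
    exact: (Step [:: 1] c d B hX hY).
  rewrite (_ : add_left p _ = 1 :: X ++ c.+1 :: d.+1 :: Y ++ 0 :: B).
    by apply: (@Step [::] (1 :: X)).
  by case: X hX => [|[|x] X] //= _; rewrite add_left_pos.
case: p => [|p]; first by rewrite !add_left0 /=; apply: (@Step [:: 1, a & A]).
case: a => [|a] /=; last by apply: (@Step [:: 1, a.+1 & A]).
by have := step_ctx [:: 0] [::] (IH p); rewrite /= !cats0.
Qed.

Lemma reach_add_left p u v : reach u v -> reach (add_left p u) (add_left p v).
Proof. exact: reach_homo (@step_add_left p) u v. Qed.

Definition alt n : seq nat := flatten (nseq n [:: 0; 1]).

(* The shadow [F_{N,k}] with [k = a + 1] and [N = a + b + 2]. *)
Definition fword a b : seq nat := (1 :: alt a) ++ [:: 0, 0, 1 & alt b].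

Lemma alt_rcons n : alt n.+1 = alt n ++ [:: 0; 1].
Proof.
by rewrite /alt -addn1 nseqD flatten_cat /=.
Qed.

Lemma rev_alt n : rev (1 :: alt n) = 1 :: alt n.
Proof.
elim: n => // n IH; rewrite {1}alt_rcons -cat_cons rev_cat IH //.
Qed.

Lemma rev_fword a b : rev (fword a b) = fword b a.
Proof.
rewrite /fword -[[:: 0, 0, 1 & _]]/([:: 0; 0] ++ (1 :: alt b)).
by rewrite !rev_cat !rev_alt -catA.
Qed.

Lemma rev_pad i j w : rev (zeros i ++ w ++ zeros j) = zeros j ++ rev w ++ zeros i.
Proof. by rewrite !rev_cat !rev_nseq catA. Qed.

(* The pair [11] travels to the right through the alternating block until it
   is absorbed by the gap [00]. *)
Lemma fword_push a b : reach (0 :: 1 :: fword a b) (fword a b.+1).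
Proof.
rewrite /fword; elim: a => [|a IH] /=.
  by apply: (@fire [::] [::] 0 0 [::] (0 :: 1 :: alt b)).
apply: (@reach_trans _ (1 :: 0 :: [:: 0; 1] ++ (1 :: alt a) ++ [:: 0, 0, 1 & alt b])).
  exact: (@fire [::] [::] 0 0 [::] (1 :: alt a ++ [:: 0, 0, 1 & alt b])).
by have := reach_ctx [:: 1; 0] [::] IH; rewrite /= !cats0.
Qed.

(* The bounds say how far [C] expands on each side. They ensure that a
   violinist waiting one empty room away from [C], or two on the left if [a = 0]
   and on the right if [b = 0], ends up next to [fword a b]. *)
Definition ends_in (C : seq nat) (a b : nat) : Prop :=
  exists i j i' j', [/\
    reach (zeros i ++ C ++ zeros j) (zeros i' ++ fword a b ++ zeros j'),
    i' < i, j' < j,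
    (a = 0 -> 0 < b -> i'.+1 < i)
    & (b = 0 -> 0 < a -> j'.+1 < j)].

Lemma ends_in_rev C a b : ends_in (rev C) b a -> ends_in C a b.
Proof.
case=> i [j [i' [j' [/reach_rev h h1 h2 h3 h4]]]].
exists j, i, j', i'; split=> //.
by move: h; rewrite !rev_pad revK rev_fword.
Qed.

Lemma zeros_cat m n (w : seq nat) : zeros m ++ zeros n ++ w = zeros (m + n) ++ w.
Proof. by rewrite catA -nseqD. Qed.

Lemma pad_pad m n i j w :
  zeros m ++ (zeros i ++ w ++ zeros j) ++ zeros n =
  zeros (m + i) ++ w ++ zeros (j + n).
Proof. by rewrite !catE zeros_cat -nseqD. Qed.

(** [D] expands while [add_left] carries the extra violinist along. The expansion covers at least
    [t] rooms on the left, so the violinist ends up right before [fword a b], and [fword_push]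
    finishes. *)
Lemma ends_in_left C D I J q t j0 a b :
    reach (zeros I ++ C ++ zeros J) (zeros q ++ 1 :: zeros t ++ D ++ zeros j0) ->
    q + (0 < t) <= I -> j0 <= J -> t <= 2 -> (t = 2 -> a = 0 /\ 0 < b) ->
    ends_in D a b ->
  ends_in C a b.+1.
Proof.
move=> hC hq hj ht ht2 [i [j [i' [j' [hD h1 h2 h3 h4]]]]].
have hit : i' + t <= i.
  case: (eqVneq t 2) => [e|]; last lia.
  by case: (ht2 e) => /h3 h /h; lia.
(* Besides the [i] rooms for [D], one more room on the left provides the leading zero that
   [fword_push] consumes. *)
exists (i.+1 + I), (J + j), (i' + q + t), (j0 + j'); split; try lia.
have {}hC := reach_ctx (zeros i.+1) (zeros j) hC.
rewrite -!catA !zeros_cat -!nseqD in hC.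
rewrite /= -!catA -nseqD in hC.
apply: reach_trans hC _.
have {}hD := reach_ctx (zeros (q + t).+1) (zeros j0) hD.
have {}hD := reach_add_left (q + i.+1) hD.
rewrite !pad_pad in hD.
rewrite (_ : (q + t).+1 + i = (q + i.+1) + t) in hD; last lia.
have e1 : add_left (q + i.+1) (zeros (q + i.+1 + t) ++ D ++ zeros (j + j0)) =
   zeros (i.+1 + q) ++ 1 :: zeros t ++ D ++ zeros (j0 + j).
  rewrite nseqD -!catA -{1}[q + i.+1]addn0 add_left_zeros add_left0.
  by rewrite [i.+1 + q]addnC [j0 + j]addnC.
rewrite e1 in hD; apply: reach_trans hD _.
(* The violinist waits in room [e], and [e'] zeros precede [fword a b]; [e' <= e] says that the
   expansion has reached it. *)
set e := q + i.+1; set e' := (q + t).+1 + i'.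
have -> : e = e' + (e - e') by rewrite /e /e'; lia.
rewrite add_left_zeros.
have -> w : add_left (e - e') (fword a b ++ w) = 1 :: fword a b ++ w.
  exact: add_left_pos.
have := reach_ctx (zeros (i' + q + t)) (zeros (j' + j0)) (fword_push a b).
rewrite [j0 + j']addnC.
rewrite (_ : e' = (i' + q + t) + 1); last by rewrite /e'; lia.
by rewrite -(zeros_cat (i' + q + t) 1).
Qed.

(** * Clusterons *)

Definition good (C : seq nat) : bool :=
  [&& all (leq 1) C, 1 < size C, C != [:: 1; 2] & C != [:: 2; 1]].

Definition solved (C : seq nat) : Prop :=
  forall a b, a + b + 2 = sumn C -> ends_in C a b.

(** A violinist detached on the left adds one to [b], so the shadow with [b = 0] is left out. *)
Definition left_solved (C : seq nat) : Prop :=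
  forall a b, a + b.+1 + 2 = sumn C -> ends_in C a b.+1.

Lemma good_rev C : good (rev C) = good C.
Proof.
rewrite /good all_rev size_rev !(can2_eq (@revK _) (@revK _)).
by congr [&& _, _ & _]; rewrite andbC.
Qed.

Lemma good_long C : all (leq 1) C -> 2 < size C -> good C.
Proof.
by case: C => [|x [|y [|z C]]] // h _; rewrite /good h !eqseq_cons !andbF.
Qed.

Lemma solved_rev C : solved (rev C) -> solved C.
Proof. by move=> h a b e; apply/ends_in_rev/h; rewrite sumn_rev; lia. Qed.

(* A violinist waiting [t <= 1] empty rooms to the left of [D] gives every
   shadow but the one with [b = 0]. *)
Lemma left_solved_of C D I J q t j0 :
    reach (zeros I ++ C ++ zeros J) (zeros q ++ 1 :: zeros t ++ D ++ zeros j0) ->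
    q + (0 < t) <= I -> j0 <= J -> t <= 1 -> sumn C = (sumn D).+1 ->
  solved D -> left_solved C.
Proof.
move=> h h1 h2 h3 h4 hD a b e.
apply: (ends_in_left h) => //; [lia | lia | apply: hD; lia].
Qed.

(* With two empty rooms in between, only the shadow with [a = 0] is
   guaranteed. *)
Lemma first_end_of C D I J q j0 :
    reach (zeros I ++ C ++ zeros J) (zeros q ++ [:: 1, 0, 0 & D ++ zeros j0]) ->
    q < I -> j0 <= J -> sumn C = (sumn D).+1 -> 2 < sumn D ->
  solved D -> ends_in C 0 (sumn C - 2).
Proof.
move=> h h1 h2 h3 h4 hD.
have -> : sumn C - 2 = (sumn D - 2).+1 by lia.
apply: (@ends_in_left C D I J q 2 j0) => //; [lia | lia | apply: hD; lia].
Qed.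

(** The first room with at least two violinists, if any, decides how a clusteron starting with [21]
    is fired. *)
Lemma split_ones A : all (leq 1) A ->
  exists s A', A = nseq s 1 ++ A' /\
    (A' = [::] \/ exists t A'', A' = t.+2 :: A'' /\ all (leq 1) A'').
Proof.
elim: A => [|[|[|x]] A IH] //=; first by exists 0, [::]; split; [|left].
  by move=> /IH [s [A' [-> h]]]; exists s.+1, A'.
by move=> h; exists 0, (x.+2 :: A); split=> //; right; exists x, A.
Qed.

Lemma all_ones n : all (leq 1) (nseq n 1).
Proof. by rewrite all_nseq orbT. Qed.

Lemma nseq_comm n (x : nat) w : nseq n x ++ x :: w = x :: nseq n x ++ w.
Proof. by elim: n => //= n ->. Qed.

(** The first two occupation numbers tell how to detach a violinist on the left within two moves. It
    ends at most one empty room away from a smaller good clusteron, except for [21...1], where it is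
    two away. *)
Lemma left_cases C :
    good C -> C != [:: 1; 1; 2] -> C != [:: 1; 2; 1] ->
    (size C == 2) && (head 0 C == 1) = false ->
    (forall D, good D -> sumn D < sumn C -> solved D) ->
  left_solved C \/
  exists s, [/\ 1 < s, C = 2 :: nseq s 1 & ends_in C 0 (sumn C - 2)].
Proof.
case/and4P; case: C => [|[|[|x]] [|[|y] A]] //= hA _ h12 h21 h112 h121 h2 IH.
  (* The first room already holds the single violinist; the excluded clusterons are those whose tail
     is not good. *)
  left; apply: (@left_solved_of _ (y.+1 :: A) 0 0 0 0 0) => //=.
    by rewrite !cats0; apply: rt_refl.
  apply: IH; last by rewrite /=; lia.
  rewrite /good /= hA; case: A y h2 h112 h121 {h12 h21 hA} => [|z A] //= y _.
  rewrite !eqseq_cons /= => h112 h121.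
  by rewrite h112 h121.
case: y h12 h21 h112 h121 h2 IH => [|y] _ h21 _ _ _ IH; last first.
  left; apply: (@left_solved_of _ (x.+1 :: y.+1 :: A ++ [:: 1]) 1 1 0 0 0) => //=.
  - by apply: (@fire [::] [::] x.+1 y.+1 A [::]) => //=; rewrite !catE.
  - by rewrite sumn_cat /=; lia.
  - apply: IH; last by rewrite /= sumn_cat /=; lia.
    by apply: good_long; rewrite /= ?size_cat ?all_cat ?hA //=; lia.
case: x h21 IH => [|x] h21 IH; last first.
  (* The first move empties the second room; the second move fires the new violinist with the large
     room and refills it. *)
  left; apply: (@left_solved_of _ (x.+1 :: 1 :: A ++ [:: 1]) 2 1 0 1 0) => //=.
  - apply: (@reach_trans _ [:: 0, 1, x.+2, 0 & A ++ [:: 1]]).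
      by apply: (@fire [:: 0] [::] x.+2 0 A [::]) => //=; rewrite !catE.
    by apply: (@fire [::] [::] 0 x.+1 [::] (A ++ [:: 1])) => //=; rewrite !catE.
  - by rewrite sumn_cat /=; lia.
  - apply: IH; last by rewrite /= sumn_cat /=; lia.
    by apply: good_long; rewrite /= ?size_cat ?all_cat ?hA //=; lia.
case: (split_ones hA) => s [A' [eA [eA'|[t [B [eA' hB]]]]]]; last first.
  (* Firing at the first later room with two or more violinists leaves a hole just before it, which
     the second move, fired at the left end, fills. *)
  left; apply: (@left_solved_of _ (1 :: nseq s 1 ++ 1 :: t.+1 :: B ++ [:: 1]) 2 1 0 1 0) => //=.
  - rewrite eA eA'; apply: (@reach_trans _ ([:: 0, 1, 2 & nseq s 1 ++ 0 :: t.+1 :: B ++ [:: 1]])).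
      apply: (@fire [:: 0] (2 :: nseq s 1) 0 t.+1 B [::]) => //=.
        by rewrite all_ones.
      by rewrite !catE nseq_comm.
    by apply: (@fire [::] [::] 0 1 (nseq s 1) (t.+1 :: B ++ [:: 1]));
      rewrite ?all_ones //= !catE.
  - by rewrite eA eA' !sumn_cat /= sumn_cat /=; lia.
  - apply: IH; last by rewrite /= eA eA' !sumn_cat /= !sumn_cat /=; lia.
    by apply: good_long; rewrite /= ?size_cat ?all_cat /= ?all_ones ?all_cat ?hB //=; lia.
right; exists s.+1; rewrite eA eA' cats0.
case: s eA => [|s] eA; first by rewrite eA eA' in h21.
split=> //.
apply: (@first_end_of _ (1 :: 1 :: nseq s 1 ++ [:: 1]) 2 1 0 0) => //=.
- apply: (@reach_trans _ [:: 0, 1, 1, 0, 1 & nseq s 1 ++ [:: 1]]).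
    apply: (@fire [:: 0] [::] 1 0 (1 :: nseq s 1) [::]) => //=.
    by rewrite all_ones.
  rewrite cats0; apply: (@fire [::] [::] 0 0 [::] (1 :: nseq s 1 ++ [:: 1])) => //=.
- by rewrite sumn_cat /=; lia.
- by rewrite sumn_cat /=; lia.
- apply: IH; last by rewrite eA eA' /= !sumn_cat /=; lia.
  by apply: good_long; rewrite /= ?size_cat ?all_cat ?all_ones //=; lia.
Qed.

(** A violinist detached on the right gives every shadow with [a > 0]; the first hypothesis supplies
    the one with [a = 0]. *)
Lemma solved_of_left C :
    left_solved C \/ ends_in C 0 (sumn C - 2) ->
    left_solved (rev C) ->
  2 < sumn C -> solved C.
Proof.
move=> hl hr hN [|a] b e; last first.
  by apply/ends_in_rev/hr; rewrite sumn_rev; lia.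
case: hl => h; last by have -> : b = sumn C - 2 by lia.
by case: b e => [|b] e; [lia | apply: h].
Qed.

(** * Exceptional small clusterons and the induction on the size *)

Lemma solved_11 : solved [:: 1; 1].
Proof.
move=> [|a] [|b] //= e; try lia.
exists 1, 1, 0, 0; split=> //.
exact: (@fire [::] [::] 0 0 [::] [::]).
Qed.

Lemma solved_112 : solved [:: 1; 1; 1] -> solved [:: 1; 1; 2].
Proof.
(* Both [112] and [211] reach this word in one move, so [r] serves the two extreme shadows. *)
have r : reach [:: 0; 1; 1; 0; 1; 1] [:: 1; 0; 0; 1; 1; 1].
  exact: (@fire [::] [::] 0 0 [::] [:: 1; 1]).
move=> h [|[|[|a]]] b /= e; last lia.
- have -> : b = 2 by lia.
  apply: (@first_end_of _ [:: 1; 1; 1] 2 1 0 0) => //=; apply: reach_trans r.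
  exact: (@fire [:: 0] [:: 1] 0 1 [::] [::]).
(* The middle shadow comes from an explicit run of six moves. *)
- have -> : b = 1 by lia.
  exists 2, 3, 0, 0; split=> //=.
  apply: (@reach_trans _ [:: 0; 1; 0; 0; 2; 1; 0; 0]).
    exact: (@fire [:: 0] [::] 0 0 [:: 2] [:: 0; 0]).
  apply: (@reach_trans _ [:: 0; 1; 0; 1; 1; 0; 1; 0]).
    exact: (@fire [:: 0; 1; 0] [::] 1 0 [::] [:: 0]).
  apply: (@reach_trans _ [:: 0; 1; 1; 0; 0; 1; 1; 0]).
    exact: (@fire [:: 0; 1] [::] 0 0 [::] [:: 1; 0]).
  apply: (@reach_trans _ [:: 1; 0; 0; 1; 0; 1; 1; 0]).
    exact: (@fire [::] [::] 0 0 [::] [:: 0; 1; 1; 0]).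
  apply: (@reach_trans _ [:: 1; 0; 0; 1; 1; 0; 0; 1]).
    exact: (@fire [:: 1; 0; 0; 1] [::] 0 0 [::] [::]).
  exact: (@fire [:: 1; 0] [::] 0 0 [::] [:: 0; 1]).
- have -> : b = 0 by lia.
  apply: ends_in_rev.
  apply: (@first_end_of [:: 2; 1; 1] [:: 1; 1; 1] 2 1 0 0) => //=.
  apply: reach_trans r.
  exact: (@fire [:: 0] [::] 1 0 [:: 1] [::]).
Qed.

(** The tail [21] is not good, but one move detaches a violinist; the word is a palindrome, so the
    left end settles the right one. *)
Lemma solved_121 : solved [:: 1; 1; 1] -> solved [:: 1; 2; 1].
Proof.
move=> h; have hl : left_solved [:: 1; 2; 1].
  apply: (@left_solved_of _ [:: 1; 1; 1] 1 1 0 1 0) => //=.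
  exact: (@fire [::] [::] 0 1 [:: 1] [::]).
by apply: solved_of_left => //; left.
Qed.

(** The tail is a single room, so it cannot serve as [D]. Three moves bring a violinist two empty
    rooms away from a clusteron with three rooms, which suffices for [a = 0]. *)
Lemma first_end_1x x : solved [:: x.+1; 1; 1] ->
  ends_in [:: 1; x.+3] 0 (sumn [:: 1; x.+3] - 2).
Proof.
apply: (@first_end_of _ _ 2 2 0 0) => //=; try lia.
apply: (@reach_trans _ [:: 0; 1; 0; x.+2; 1; 0]).
  exact: (@fire [:: 0] [::] 0 x.+2 [::] [:: 0]).
apply: (@reach_trans _ [:: 0; 1; 1; x.+1; 0; 1]).
  exact: (@fire [:: 0; 1] [::] x.+1 0 [::] [::]).
exact: (@fire [::] [::] 0 0 [:: x.+1] [:: 1]).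
Qed.

Lemma left_or_first_end C :
    good C -> 2 < sumn C -> C != [:: 1; 1; 2] -> C != [:: 1; 2; 1] ->
    (forall D, good D -> sumn D < sumn C -> solved D) ->
  left_solved C \/ ends_in C 0 (sumn C - 2).
Proof.
move=> hC h3 n112 n121 IH.
case e: ((size C == 2) && (head 0 C == 1)); last first.
  by case: (left_cases hC n112 n121 e IH) => [|[s []]]; [left | right].
right; move: e hC h3 IH; case: C {n112 n121} => [|x [|y [|z A]]] //=.
move=> /eqP->; case: y => [|[|[|y]]] // hC _ IH; apply: first_end_1x; apply: IH; last by rewrite /=; lia.
exact: good_long.
Qed.

(** The left end fails only for [1x] and [21...1], and neither form has a reverse that fails too. *)
Lemma left_or_right C :
    good C -> 2 < sumn C -> C != [:: 1; 1; 2] -> C != [:: 1; 2; 1] ->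
    C != [:: 2; 1; 1] ->
    (forall D, good D -> sumn D < sumn C -> solved D) ->
  left_solved C \/ left_solved (rev C).
Proof.
move=> hC h3 n112 n121 n211 IH.
have hCr : good (rev C) by rewrite good_rev.
have IHr D : good D -> sumn D < sumn (rev C) -> solved D.
  by rewrite sumn_rev; apply: IH.
have n112r : rev C != [:: 1; 1; 2] by rewrite (can2_eq (@revK _) (@revK _)).
have n121r : rev C != [:: 1; 2; 1] by rewrite (can2_eq (@revK _) (@revK _)).
have hl := left_cases hC n112 n121 _ IH.
have hr := left_cases hCr n112r n121r _ IHr.
case e: ((size C == 2) && (head 0 C == 1)).
  right; move: e hC h3 {hl} hr.
  case: C {IH n112 n121 n211 hCr IHr n112r n121r} => [|x [|y [|z A]]] //=.
  move=> /eqP->; case: y => [|[|[|y]]] // _ _ [] // [s [hs /(congr1 size)]].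
  by rewrite size_rev /= size_nseq; lia.
case: hl => // [|[s [hs eC _]]]; first by left.
right; case: hr => [| //|[s' [_]]]; rewrite eC.
  by case: s hs {eC} => [|[|s]] // _; rewrite size_rev.
move=> /(congr1 (head 0)) /=; case: s hs {eC} => // s _.
by rewrite rev_cons rev_nseq.
Qed.

Lemma good_solved C : good C -> solved C.
Proof.
have [n] := ubnP (sumn C); elim: n C => // n IHn C hn hC.
have {}IHn D : good D -> sumn D < sumn C -> solved D.
  by move=> hD hDC; apply: IHn => //; lia.
have IHr D : good D -> sumn D < sumn (rev C) -> solved D.
  by rewrite sumn_rev; apply: IHn.
have [h3|h3] := leqP (sumn C) 2.
  suff -> : C = [:: 1; 1] by exact: solved_11.
  have [hp hs _ _] := and4P hC.
  by case: (C) hp hs h3 => [|[|[|x]] [|[|[|y]] [|[|z] A]]] //= _ _; lia.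
have [e|n112] := eqVneq C [:: 1; 1; 2].
  by rewrite e; apply/solved_112/IHn; rewrite ?e.
have [e|n211] := eqVneq C [:: 2; 1; 1].
  by rewrite e; apply/solved_rev/solved_112/IHn; rewrite ?e.
have [e|n121] := eqVneq C [:: 1; 2; 1].
  by rewrite e; apply/solved_121/IHn; rewrite ?e.
(* One end gives all shadows but one, and the other end gives the missing one by
   [left_or_first_end]. *)
case: (left_or_right hC h3 n112 n121 n211 IHn) => h; last first.
  by apply: solved_of_left => //; apply: left_or_first_end.
apply/solved_rev/solved_of_left; rewrite ?revK ?sumn_rev //.
rewrite -sumn_rev; apply: left_or_first_end => //; rewrite ?good_rev ?sumn_rev //.
- by rewrite (can2_eq (@revK _) (@revK _)).
- by rewrite (can2_eq (@revK _) (@revK _)).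
Qed.

(** * From words to states *)

Import Order.TTheory GRing.Theory Num.Theory.
Local Open Scope ring_scope.

Definition cells (p : int) (n : nat) : seq int := [seq p + k%:Z | k <- iota 0 n].

(** On the window [j] is at least [p], so the absolute value is the exact offset. *)
Definition state_of (p : int) (w : seq nat) : state :=
  [fsfun j in [fset x in cells p (size w)]%fset =>
    nth 0%N w `|j - p|%N].

Lemma state_ofE p w k : state_of p w (p + k%:Z) = nth 0%N w k.
Proof.
rewrite fsfunE inE; case: ifP => [_|/mapP h]; first by congr nth; lia.
rewrite nth_default // leqNgt; apply/negP => hk; apply: h.
by exists k; rewrite ?mem_iota.
Qed.

Lemma state_of_lt p w j : j < p -> state_of p w j = 0%N.
Proof.
by move=> hj; rewrite fsfunE inE; case: ifP => // /mapP [k _ e]; lia.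
Qed.

Lemma offsetP (p j : int) : {k : nat | j = p + k%:Z} + {j < p}.
Proof.
case: (ltP j p) => h; [by right | left; exists `|j - p|%N; lia].
Qed.

(** The equation of [move] read on words: rooms [i] and [i.+1] fire, [size A] and [r] are the free
    rooms that get filled. *)
Lemma nth_step A X c d Y B k :
  let w := A ++ 0%N :: X ++ c.+1 :: d.+1 :: Y ++ 0%N :: B in
  let w' := A ++ 1%N :: X ++ c :: d :: Y ++ 1%N :: B in
  let i := (size A + size X).+1 in
  let r := (i + size Y).+2 in
  nth 0%N w' k =
    (nth 0%N w k - ((k == i) || (k == i.+1)) + ((k == size A) || (k == r)))%N.
Proof.
move=> w w' i r; rewrite /w /w' /i /r.
case: (ltnP k (size A)) => h0; first by rewrite !nth_cat h0; lia.
have -> : k = (size A + (k - size A))%N by lia.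
move: (k - size A)%N => {h0}k.
rewrite !nth_cat !addKn; have -> : ((size A + k < size A) = false)%N by lia.
case: k => [|k] /=; first by lia.
case: (ltnP k (size X)) => h0; first by rewrite !nth_cat h0; lia.
have -> : k = (size X + (k - size X))%N by lia.
move: (k - size X)%N => {h0}k.
rewrite !nth_cat !addKn; have -> : ((size X + k < size X) = false)%N by lia.
case: k => [|[|k]] /=; [by lia | by lia |].
case: (ltnP k (size Y)) => h0; first by rewrite !nth_cat h0; lia.
have -> : k = (size Y + (k - size Y))%N by lia.
move: (k - size Y)%N => {h0}k.
rewrite !nth_cat !addKn; have -> : ((size Y + k < size Y) = false)%N by lia.
by case: k => [|k] /=; lia.
Qed.

Lemma all_pos_nth w k : all (leq 1) w -> (k < size w)%N -> nth 0%N w k != 0%N.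
Proof. by move=> /all_nthP h /h => /(_ 0%N); rewrite lt0n. Qed.

Lemma move_state_of p u v : step u v -> move (state_of p u) (state_of p v).
Proof.
case=> A X c d Y B hX hY.
set w := A ++ 0%N :: X ++ _.
set i := (size A + size X).+1; set r := (i + size Y).+2.
have nX k : (size A < k < i)%N -> nth 0%N w k != 0%N.
  move=> hk; rewrite /w nth_cat; have -> : ((k < size A) = false)%N by lia.
  have [k' -> {hk} hk'] : exists2 k', (k - size A = k'.+1)%N & (k' < size X)%N.
    by exists (k - size A).-1; lia.
  by rewrite /= nth_cat hk' all_pos_nth.
have nY k : (i.+1 < k < r)%N -> nth 0%N w k != 0%N.
  move=> hk; rewrite /w nth_cat; have -> : ((k < size A) = false)%N by lia.
  have [k' -> {hk} hk'] : exists2 k',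
      (k - size A = (size X + k'.+2).+1)%N & (k' < size Y)%N.
    by exists (k - i).-2; lia.
  rewrite /= nth_cat addKn; have -> : ((size X + k'.+2 < size X) = false)%N by lia.
  by rewrite /= nth_cat hk' all_pos_nth.
have wl : nth 0%N w (size A) = 0%N by rewrite /w nth_cat ltnn subnn.
have wi : nth 0%N w i = c.+1.
  rewrite /w nth_cat; have -> : ((i < size A) = false)%N by lia.
  rewrite (_ : (i - size A)%N = (size X).+1); last lia.
  by rewrite /= nth_cat ltnn subnn.
have wi1 : nth 0%N w i.+1 = d.+1.
  rewrite /w nth_cat; have -> : ((i.+1 < size A) = false)%N by lia.
  rewrite (_ : (i.+1 - size A)%N = (size X + 1).+1); last lia.
  rewrite /= nth_cat addKn.
  by have -> : ((size X + 1 < size X) = false)%N by lia.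
have wr : nth 0%N w r = 0%N.
  rewrite /w nth_cat; have -> : ((r < size A) = false)%N by lia.
  rewrite (_ : (r - size A)%N = (size X + (size Y).+2).+1); last lia.
  rewrite /= nth_cat addKn.
  have -> : ((size X + (size Y).+2 < size X) = false)%N by lia.
  by rewrite /= nth_cat ltnn subnn.
have eS : p + i%:Z + 1 = p + (i.+1)%:Z by lia.
exists (p + i%:Z), (p + (size A)%:Z), (p + r%:Z); split.
- by rewrite /occupied state_ofE wi.
- by rewrite /occupied eS state_ofE wi1.
- split; [lia | by rewrite state_ofE |].
  move=> j hj; case: (offsetP p j) => [[k ek]|]; last lia.
  rewrite ek state_ofE => h0; suff : ~~ (size A < k)%N by lia.
  by apply/negP => hk; move: (nX k); rewrite h0; lia.
- split; [lia | by rewrite state_ofE |].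
  move=> j hj; case: (offsetP p j) => [[k ek]|]; last lia.
  rewrite ek state_ofE => h0; suff : ~~ (k < r)%N by lia.
  by apply/negP => hk; move: (nY k); rewrite h0; lia.
- move=> j; case: (offsetP p j) => [[k ->]|hj].
    rewrite !state_ofE nth_step eS -/w -/i -/r.
    by rewrite !(inj_eq (addrI p)).
  rewrite !state_of_lt //; lia.
Qed.

Lemma reachable_state_of p u v :
  reach u v -> reachable (state_of p u) (state_of p v).
Proof.
elim=> [x y h|x|x y z _ h1 _ h2]; first exact/rt_step/move_state_of.
  exact: rt_refl.
exact: rt_trans h1 h2.
Qed.

Lemma state_ofP (a : state) p n :
    (forall j : int, a j != 0%N -> p <= j < p + n%:Z) ->
  a = state_of p [seq a j | j <- cells p n].
Proof.
move=> h; apply/fsfunP => j; case: (offsetP p j) => [[k ->]|hj]; last first.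
  rewrite state_of_lt //; apply/eqP/negPn/negP => /h; lia.
rewrite state_ofE /cells -map_comp.
case: (ltnP k n) => hk; last first.
  rewrite nth_default ?size_map ?size_iota //.
  by apply/eqP/negPn/negP => /h; lia.
by rewrite (nth_map 0%N) ?size_iota //= nth_iota.
Qed.

Lemma state_of_pad p i j w :
  state_of p (zeros i ++ w ++ zeros j) = state_of (p + i%:Z) w.
Proof.
apply/fsfunP => x; case: (offsetP (p + i%:Z) x) => [[k ->]|hx].
  rewrite state_ofE -addrA -PoszD state_ofE nth_cat size_nseq addKn.
  have -> : ((i + k < i) = false)%N by lia.
  rewrite nth_cat; case: ltnP => // hk.
  by rewrite nth_nseq if_same nth_default.
rewrite (state_of_lt _ hx); case: (offsetP p x) => [[k ek]|hp].
  rewrite ek state_ofE nth_cat size_nseq.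
  have -> : (k < i)%N by lia.
  by rewrite nth_nseq if_same.
by rewrite state_of_lt.
Qed.

Lemma roomsE l (n : nat) : rooms l (l + n%:Z) = cells l n.+1.
Proof. by rewrite /rooms /cells; congr [seq _ | _ <- iota _ _]; lia. Qed.

Lemma state_of_cells p w : [seq state_of p w j | j <- cells p (size w)] = w.
Proof.
transitivity [seq nth 0%N w k | k <- iota 0 (size w)].
  by rewrite /cells -map_comp; apply: eq_map => k /=; rewrite state_ofE.
by rewrite map_nth_iota0 ?take_size.
Qed.

Lemma final_state_of p w :
  sorted (fun x y => (x == 0%N) || (y == 0%N)) w -> final (state_of p w).
Proof.
move=> /(sortedP 0%N) h [b [i [l [r [o1 o2 _ _ _]]]]].
move: o1 o2; rewrite /occupied; case: (offsetP p i) => [[k ->]|hi]; last first.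
  by rewrite state_of_lt.
have -> : p + k%:Z + 1 = p + k.+1%:Z by lia.
rewrite !state_ofE => h1 h2; have hk : (k.+1 < size w)%N.
  by rewrite ltnNge; apply/negP => hk; rewrite nth_default in h2.
by move: (h k hk); lia.
Qed.

Lemma shadow_state_of p w : (0 < head 0 w)%N -> (0 < last 0 w)%N ->
  has_shadow (state_of p w) [seq (0 < x)%N | x <- w].
Proof.
move=> h1 h2; case ew: w => [|x w']; first by rewrite ew in h1.
have o j : occupied (state_of p w) j -> p <= j <= p + (size w')%:Z.
  rewrite /occupied; case: (offsetP p j) => [[k ->]|/state_of_lt -> //].
  rewrite state_ofE => hk; suff : (k < size w)%N by rewrite ew /=; lia.
  by rewrite ltnNge; apply/negP => hk'; rewrite nth_default in hk.
rewrite -ew; exists p, (p + (size w')%:Z); split.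
- split; last by move=> j /o /andP[].
  by have := state_ofE p w 0; rewrite addr0 /occupied nth0 => ->.
- split; last by move=> j /o /andP[].
  rewrite /occupied state_ofE (_ : size w' = (size w).-1) ?nth_last //.
  by rewrite ew.
- rewrite roomsE -[in LHS](state_of_cells p w) -map_comp ew.
  by apply: eq_map => j.
Qed.

Lemma Fword_iota k s n : (k < s)%N || (s + n <= k)%N ->
  flatten [seq (if j == k then [:: false; false; true]
                else [:: false; true]) | j <- iota s n] =
  flatten (nseq n [:: false; true]).
Proof.
elim: n s => //= n IH s h; rewrite IH; last lia.
by have -> : (s == k) = false by lia.
Qed.

Lemma map_alt n : [seq (0 < x)%N | x <- alt n] = flatten (nseq n [:: false; true]).
Proof. by elim: n => //= n ->. Qed.

Lemma Fword_split a b : Fword (a + b + 2) a.+1 =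
  true :: flatten (nseq a [:: false; true]) ++
    [:: false, false, true & flatten (nseq b [:: false; true])].
Proof.
rewrite /Fword (_ : (a + b + 2).-1 = a + b.+1)%N; last lia.
rewrite iotaD map_cat flatten_cat /= !Fword_iota; [|lia|lia].
by rewrite add1n eqxx.
Qed.

Lemma map_fword a b : [seq (0 < x)%N | x <- fword a b] = Fword (a + b + 2) a.+1.
Proof. by rewrite Fword_split /fword map_cat /= !map_alt. Qed.

Lemma last_alt n : last 1%N (alt n) = 1%N.
Proof. by elim: n. Qed.

Lemma sorted_fword a b : sorted (fun x y => (x == 0%N) || (y == 0%N)) (fword a b).
Proof.
have h n : path (fun x y => (x == 0%N) || (y == 0%N)) 1%N (alt n) by elim: n.
by rewrite /fword /= cat_path h /= h orbT.
Qed.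

(** * Conservation of the size *)

Lemma state_size_uniq (a : state) (s : seq int) :
  uniq s -> (forall j, a j != 0%N -> j \in s) ->
  state_size a = (\sum_(j <- s) a j)%N.
Proof.
move=> us hs; rewrite /state_size.
rewrite [RHS](bigID (fun j => a j != 0%N)) /= [X in (_ + X)%N]big1 ?addn0; last first.
  by move=> j /negPn/eqP.
rewrite -[RHS]big_filter; apply/perm_big/uniq_perm.
- exact: fset_uniq.
- exact: filter_uniq.
- move=> j; rewrite mem_filter mem_finsupp.
  by case: (boolP (a j != 0%N)) => //= /hs ->.
Qed.

Lemma move_size (a b : state) : move a b -> state_size b = state_size a.
Proof.
case=> i [l [r [o1 o2 [hl al _] [hr ar _] e]]].
pose s := undup ([:: i; i + 1; l; r] ++ finsupp a ++ finsupp b).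
have us : uniq s by apply: undup_uniq.
have hs x j : (x = a \/ x = b) -> x j != 0%N -> j \in s.
  move=> hx; rewrite -mem_finsupp mem_undup !mem_cat.
  by case: hx => -> ->; rewrite ?orbT.
have c x : x \in [:: i; i + 1; l; r] -> (\sum_(j <- s) (j == x))%N = 1%N.
  move=> hx; transitivity (\sum_(j <- s | j == x) 1)%N; first by rewrite [RHS]big_mkcond.
  rewrite sum1_count count_uniq_mem //.
  by rewrite /s mem_undup mem_cat hx.
rewrite (state_size_uniq us (fun j => hs a j (or_introl erefl))).
rewrite (state_size_uniq us (fun j => hs b j (or_intror erefl))).
(* Departures are added to the side of [b], because truncated subtraction does not commute with
   sums. *)
have : (\sum_(j <- s) (b j + (j == i) + (j == (i + 1)%R)) =
        \sum_(j <- s) (a j + (j == l) + (j == r)))%N.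
  apply: eq_bigr => j _; rewrite e.
  have h1 : j == i -> (0 < a j)%N by move/eqP->.
  have h2 : j == i + 1 -> (0 < a j)%N by move/eqP->.
  lia.
rewrite !big_split /= !c ?inE ?eqxx ?orbT //; lia.
Qed.

(** * Invariants and final states *)

(** Rooms [lo] and [hi] make the gaps internal. With [y = x + 1] no [z] exists, so the second
    property also forbids [000] between occupied rooms. *)
Definition invariant (a : state) : Prop := [/\
  forall j, (1 < a j)%N -> occupied a (j - 1) || occupied a (j + 1),
  forall lo x y hi, lo < x -> x < y -> y + 1 < hi ->
    occupied a lo -> occupied a hi ->
    a x = 0%N -> a (x + 1) = 0%N -> a y = 0%N -> a (y + 1) = 0%N ->
    exists2 z, x < z < y & occupied a z && occupied a (z + 1)
  & (exists x, occupied a x && occupied a (x + 1)) \/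
    exists lo x hi, [/\ lo < x, x + 1 < hi, occupied a lo && occupied a hi,
                        a x = 0%N & a (x + 1) = 0%N] ].

Lemma moveP (a b : state) : move a b -> exists i l r : int,
  [/\ l < i, i + 1 < r, (a l = 0)%N, (a r = 0)%N
    & forall j, l < j < r -> (0 < a j)%N] /\
  [/\ b l = 1%N, b r = 1%N, b i = (a i).-1, b (i + 1) = (a (i + 1)).-1
    & forall j, j != i -> j != i + 1 -> j != l -> j != r -> b j = a j].
Proof.
case=> i [l [r [o1 o2 [hl al Hl] [hr ar Hr] e]]].
exists i, l, r; split; split=> //.
- move=> j hj; rewrite lt0n; apply/negP => /eqP h0.
  case: (ltP j i) => h1; first by have := Hl j h1 h0; lia.
  case: (ltP (i + 1) j) => h2; first by have := Hr j h2 h0; lia.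
  have [ej|ej] : j = i \/ j = i + 1 by lia.
    by rewrite ej in h0; rewrite /occupied h0 in o1.
  by rewrite ej in h0; rewrite /occupied h0 in o2.
- by rewrite e al eqxx.
- by rewrite e ar eqxx orbT.
- rewrite e eqxx /=; lia.
- rewrite e eqxx orbT /=; lia.
- move=> j h1 h2 h3 h4; rewrite e; lia.
Qed.

(** After a move the rooms from [l] to [r] are occupied except possibly [i] and [i + 1], and nothing
    changes outside. So at most one gap is new, and it lies at [i]. *)
Lemma move_invariant (a b : state) : move a b -> invariant a -> invariant b.
Proof.
move=> /moveP [i [l [r [[hl hr al ar ha] [bl br bi bi1 be]]]]] [I1 I2 _].
have b_out j : j < l \/ r < j -> b j = a j by move=> hj; apply: be; lia.
have b_in j : l <= j <= r -> j != i -> j != i + 1 -> (0 < b j)%N.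
  move=> hj n1 n2; case: (eqVneq j l) => [->|n3]; first by rewrite bl.
  case: (eqVneq j r) => [->|n4]; first by rewrite br.
  by rewrite be // ha //; lia.
have b_mono j : j < i \/ i + 1 < j -> (a j <= b j)%N.
  case: (eqVneq j l) => [->|n3]; first by rewrite al.
  case: (eqVneq j r) => [->|n4]; first by rewrite ar.
  by move=> hj; rewrite be //; lia.
have b_gap x : b x = 0%N -> b (x + 1) = 0%N ->
    [\/ x = i, x + 1 < l /\ a x = 0%N /\ a (x + 1) = 0%N
      | r < x /\ a x = 0%N /\ a (x + 1) = 0%N].
  move=> h0 h1; case: (eqVneq x i) => [|n]; first by constructor 1.
  have m1 := b_in x; have m2 := b_in (x + 1).
  case: (ltP (x + 1) l) => h2; first by constructor 2; rewrite -!b_out //; lia.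
  case: (ltP r x) => h3; first by constructor 3; rewrite -!b_out //; lia.
  by rewrite h0 h1 in m1 m2; lia.
split.
- move=> j; rewrite /occupied => hj.
  case: (ltP j l) => h1.
    move: hj (I1 j) (b_mono (j - 1)) (b_mono (j + 1)); rewrite b_out /occupied; lia.
  case: (ltP r j) => h2.
    move: hj (I1 j) (b_mono (j - 1)) (b_mono (j + 1)); rewrite b_out /occupied; lia.
  have n1 : j != l by apply/eqP => ej; rewrite ej bl in hj.
  have n2 : j != r by apply/eqP => ej; rewrite ej br in hj.
  (* Between [l] and [r], the neighbour on the side away from the fired pair is occupied. *)
  case: (leP j i) => h3; first by rewrite b_in //; lia.
  by rewrite orbC b_in //; lia.
- have oi : occupied a i by apply: ha; lia.
  (* Either [l - 1] was occupied and now pairs with [l], or [l - 1] and [l] formed a gap of [a] and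
     [I2] gives the pair. *)
  have wl lo x : lo < x -> x + 1 < l -> occupied b lo -> a x = 0%N ->
      a (x + 1) = 0%N -> exists2 z, x < z < l & occupied b z && occupied b (z + 1).
    rewrite /occupied => h1 h2; rewrite b_out; last lia.
    move=> h3 h4 h5; case: (posnP (a (l - 1))) => h6; last first.
      exists (l - 1); last by rewrite subrK bl b_out ?h6 //; lia.
      case: (eqVneq (x + 1) (l - 1)) => [e|]; last lia.
      by rewrite -e h5 in h6.
    case: (I2 lo x (l - 1) i); rewrite ?subrK //; try lia.
    move=> z hz hz'.
    by exists z; [lia | rewrite !b_out //; lia].
  have wr y hi : r < y -> y + 1 < hi -> occupied b hi -> a y = 0%N ->
      a (y + 1) = 0%N -> exists2 z, r <= z < y & occupied b z && occupied b (z + 1).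
    rewrite /occupied => h1 h2; rewrite b_out; last lia.
    move=> h3 h4 h5; case: (posnP (a (r + 1))) => h6; last first.
      exists r; last by rewrite br b_out ?h6 //; lia.
      lia.
    case: (I2 i r y hi) => //; first lia.
    move=> z hz hz'.
    by exists z; [lia | rewrite !b_out //; lia].
  move=> lo x y hi h1 h2 h3 o1 o2 x0 x1 y0 y1.
  case: (b_gap x x0 x1) => [ex|[hx [ax ax1]]|[hx [ax ax1]]].
  + case: (b_gap y y0 y1) => [ey|[hy [ay ay1]]|[hy [ay ay1]]]; [lia|lia|].
    by have [z hz hz'] := wr y hi hy h3 o2 ay ay1; exists z; first lia.
  + have [z hz hz'] := wl lo x h1 hx o1 ax ax1.
    case: (b_gap y y0 y1) => [ey|[hy [ay ay1]]|[hy [ay ay1]]].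
    * by exists z; first lia.
    * move: o1; rewrite /occupied b_out; last lia.
      (* Room [i] replaces [hi], which may have become occupied only by this move. *)
      move=> o1; case: (I2 lo x y i) => //; first lia.
      move=> z' hy' hy''.
      by exists z' => //; rewrite /occupied !b_out //; lia.
    * by exists z; first lia.
  + case: (b_gap y y0 y1) => [ey|[hy [ay ay1]]|[hy [ay ay1]]]; [lia|lia|].
    move: o2; rewrite /occupied b_out; last lia.
    move=> o2; case: (I2 i x y hi) => //; first lia.
    move=> z' hy' hy''.
    by exists z' => //; rewrite /occupied !b_out //; lia.
(* A fired room that stays occupied pairs with its outer neighbour; if both become empty, they form
   a gap between [l] and [r]. *)
- case: (posnP (b i)) => e1; last first.
    left; exists (i - 1); rewrite /occupied subrK e1 andbT; apply: b_in; lia.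
  case: (posnP (b (i + 1))) => e2; last first.
    left; exists (i + 1); rewrite /occupied e2; apply: b_in; lia.
  right; exists l, i, r; split=> //; first by rewrite /occupied bl br.
Qed.

Lemma support_bound (a : state) : exists M : nat, forall j : int, a j != 0%N -> (`|j| < M)%N.
Proof.
exists (\max_(j <- finsupp a) `|j|%N).+1 => j; rewrite -mem_finsupp => hj.
by rewrite ltnS (leq_bigmax_seq (F := absz)).
Qed.

Lemma free_left (a : state) (i : int) : exists l, nearest_free_left a i l.
Proof.
have [M hM] := support_bound a.
have h : exists n, a (i - n.+1%:Z) == 0%N.
  by exists (`|i| + M)%N; apply/negPn/negP => /hM; lia.
exists (i - (ex_minn h).+1%:Z); case: ex_minnP => n /eqP hn hmin.
split=> //; first lia.
move=> j hj /eqP h0; have := hmin (absz (i - j - 1)%R).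
rewrite (_ : i - _ = j); last lia.
by move=> /(_ h0); lia.
Qed.

Lemma free_right (a : state) (i : int) : exists r, nearest_free_right a i r.
Proof.
have [M hM] := support_bound a.
have h : exists n, a (i + n.+1%:Z) == 0%N.
  by exists (`|i| + M)%N; apply/negPn/negP => /hM; lia.
exists (i + (ex_minn h).+1%:Z); case: ex_minnP => n /eqP hn hmin.
split=> //; first lia.
move=> j hj /eqP h0; have := hmin (absz (j - i - 1)%R).
rewrite (_ : i + _ = j); last lia.
by move=> /(_ h0); lia.
Qed.

(** Finite support provides a free room on each side, so an adjacent occupied pair always allows a
    move. *)
Lemma final_isolated (a : state) i :
  final a -> occupied a i -> occupied a (i + 1) -> False.
Proof.
move=> fa o1 o2; apply: fa.
have [l hl] := free_left a i; have [r hr] := free_right a (i + 1).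
pose f j := (a j - ((j == i) || (j == i + 1)%R) + ((j == l) || (j == r)))%N.
exists [fsfun j in (finsupp a `|` [fset l; r])%fset => f j].
exists i, l, r; split=> // j; rewrite fsfunE -/(f j).
case: ifP => //; rewrite !inE /f mem_finsupp; lia.
Qed.

Lemma shadow_no_gap u :
    last true u ->
    (forall k, (k < size u)%N ->
       nth false (true :: u) k (+) nth false (true :: u) k.+1) ->
  exists b, u = flatten (nseq b [:: false; true]).
Proof.
have [n] := ubnP (size u); elim: n u => // n IH [|x [|y u]] hn hlast h.
- by exists 0%N.
- by case: x {hn} hlast h => // _ /(_ 0%N isT).
- move: (h 0%N isT) (h 1%N isT) hlast; case: x h hn => //; case: y => //= h hn _ _ hlast.
  have [|||b ->] := IH u => //; first by move: hn => /=; lia.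
    by move=> k hk; apply: (h k.+2).
  by exists b.+1.
Qed.

(** Blocks [01] are stripped until the gap comes first; what follows it alternates strictly. *)
Lemma shadow_one_gap u x :
    last true u ->
    (forall k, nth false (true :: u) k -> nth false (true :: u) k.+1 -> False) ->
    (x < size u)%N ->
    (forall k, (k < size u)%N ->
      ~~ nth false (true :: u) k && ~~ nth false (true :: u) k.+1 = (k == x)) ->
  exists a b, u = flatten (nseq a [:: false; true]) ++
    [:: false, false, true & flatten (nseq b [:: false; true])].
Proof.
have [n] := ubnP (size u); elim: n u x => // n IH [|y [|z u]] x hn hlast h11 hx hg.
- by [].
- by case: y {hg hn hx} hlast h11 => // _ /(_ 0%N isT isT).
- case: y h11 hg hlast hx hn => h11 hg; first by case: (h11 0%N).
  case: z h11 hg => h11 hg hlast hx hn.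
    case: x hg hx => [|[|x]] hg hx; [by move: (hg 0%N isT)|by move: (hg 1%N isT)|].
    have [|||||a [b ->]] := IH u x => //.
    + by move: hn => /=; lia.
    + by move=> k; apply: (h11 k.+2).
    + by move=> k hk; apply: (hg k.+2).
    + by exists a.+1, b.
  (* Indices refer to [true :: u], so a gap made of the first two letters of [u] has index 1. *)
  have ex : x = 1%N by move: (hg 1%N isT) => /=; lia.
  case: u hn h11 hg hlast {hx} => [|[] u] hn h11 hg hlast //; last first.
    by move: (hg 2%N isT); rewrite ex.
  exists 0%N; have [|k hk|b ->] := @shadow_no_gap u; [by []| |by exists b].
  move: (hg k.+3) (h11 k.+3); rewrite ex /= => /(_ hk).
  by case: (nth _ _ _); case: (nth _ _ _) => // _ /(_ isT isT).
Qed.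

Lemma reachable_invariant (a b : state) : reachable a b -> invariant a ->
  invariant b /\ state_size b = state_size a.
Proof.
elim=> [x y h hx|x //|x y z _ h1 _ h2 /h1 [/h2 [hz ->] ->] //].
by split; [apply: move_invariant h hx | apply: move_size].
Qed.

Lemma final_at_most_one (a : state) :
  invariant a -> final a -> at_most_one_per_room a.
Proof.
move=> [I1 _ _] fa j; rewrite leqNgt; apply/negP => hj.
have oj : occupied a j by rewrite /occupied; lia.
case/orP: (I1 j hj) => o; last exact: final_isolated fa oj o.
by apply: (final_isolated fa o); rewrite subrK.
Qed.

Lemma cells_uniq p n : uniq (cells p n).
Proof. by rewrite map_inj_uniq ?iota_uniq // => x y; lia. Qed.

Lemma mem_cells p n j : (j \in cells p n) = (p <= j < p + n%:Z).
Proof.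
apply/mapP/idP => [[k]|h]; first by rewrite mem_iota; lia.
by exists `|j - p|%N; rewrite ?mem_iota; lia.
Qed.

Lemma count_gaps n : count id (flatten (nseq n [:: false; true])) = n.
Proof. by elim: n => //= n ->. Qed.

(** Without adjacent occupied rooms, the third property leaves an internal gap and the second
    forbids another one. The number of ones is then the size. *)
Lemma final_shadow (a : state) w :
  invariant a -> final a -> has_shadow a w -> Ffamily (state_size a) w.
Proof.
move=> Ia fa [l [r [[ol hl] [or hr] ew]]].
have a1 := final_at_most_one Ia fa.
have hlr := hl r or; pose n := `|r - l|%N.
have er : r = l + n%:Z by lia.
rewrite er roomsE in ew; move: Ia => [_ I2 I3].
have nw k : nth false w k = occupied a (l + k%:Z).
  case: (ltnP k n.+1) => hk; last first.
    rewrite nth_default ?ew ?size_map ?size_iota //.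
    by apply/esym/negP => /hr; lia.
  rewrite ew (nth_map 0) ?size_map ?size_iota // (nth_map 0%N) ?size_iota //.
  by rewrite nth_iota.
have sw : size w = n.+1 by rewrite ew !size_map size_iota.
have h11 k : nth false w k -> nth false w k.+1 -> False.
  rewrite !nw => o1; rewrite (_ : l + k.+1%:Z = l + k%:Z + 1); last lia.
  exact: final_isolated.
case: I3 => [[x /andP[o1 o2]]|[lo [x0 [hi [h1 h2 /andP[o1 o2] x0' x1']]]]].
  by case: (final_isolated fa o1 o2).
have hx0 := hl lo o1; have hx1 := hr hi o2.
(* Both end rooms are occupied, so every [00] of the word is internal. *)
have hgap (k : nat) : (k < n)%N -> ~~ nth false w k && ~~ nth false w k.+1 ->
    [/\ l < l + k%:Z, l + k%:Z + 1 < r, a (l + k%:Z) = 0%N & a (l + k%:Z + 1) = 0%N].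
  rewrite !nw (_ : l + k.+1%:Z = l + k%:Z + 1); last lia.
  move=> hk /andP[n1 n2]; split.
  - have : k != 0%N by apply: contraNneq n1 => ->; rewrite addr0.
    lia.
  - have : l + k%:Z + 1 != r by apply: contraNneq n2 => ->.
    lia.
  - by move: n1; rewrite /occupied; lia.
  - by move: n2; rewrite /occupied; lia.
pose x := `|x0 - l|%N.
have ex : l + x%:Z = x0 by lia.
have nopair z : occupied a z && occupied a (z + 1) -> False.
  by case/andP; apply: final_isolated.
have hg k : (k < n)%N -> ~~ nth false w k && ~~ nth false w k.+1 = (k == x).
  move=> hk; apply/idP/eqP => [/(hgap k hk) [g1 g2 g3 g4]|->].
    apply/eqP/negPn/negP => nkx; have [hkx|hkx] : (k < x \/ x < k)%N by lia.
      by case: (I2 l (l + k%:Z) x0 r) => //; [lia|lia|move=> z _ /nopair].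
    by case: (I2 l x0 (l + k%:Z) r) => //; [lia|lia|move=> z _ /nopair].
  rewrite !nw ex (_ : l + x.+1%:Z = x0 + 1); last lia.
  by rewrite /occupied x0' x1'.
have lw : nth false w n by rewrite nw -er.
have : nth false w 0 by rewrite nw addr0.
have ecount : state_size a = count id w.
  rewrite (state_size_uniq (cells_uniq l n.+1)); last first.
    move=> j hj; rewrite mem_cells.
    have oj : occupied a j by rewrite /occupied lt0n.
    by have := hl j oj; have := hr j oj; lia.
  rewrite ew count_map -sum1_count [RHS]big_mkcond; apply: eq_bigr => j _ /=.
  by rewrite /occupied; move: (a1 j); case: (a j) => [|[|]].
case: w nw sw h11 hgap hg lw ecount {ew} => [|[] u] //= nw [su] h11 hgap hg lw ecount _.
have [||||a' [b' eu]] := @shadow_one_gap u x.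
- by rewrite (last_nth false) su.
- exact: h11.
- by rewrite su; lia.
- by rewrite su.
rewrite ecount eu count_cat /= !count_gaps; exists a'.+1; split; first lia.
by rewrite (_ : _ + _ = a' + b' + 2)%N ?Fword_split //; lia.
Qed.

Lemma clusteron_invariant (C : state) m n : (1 < n)%N ->
  (forall i, occupied C i = (m <= i < m + n%:Z)) -> invariant C.
Proof.
move=> hn hC; split.
- move=> j hj; have : occupied C j by rewrite /occupied; lia.
  by rewrite !hC; lia.
- move=> lo x y hi h1 h2 h3; rewrite !hC => o1 o2 x0.
  by move: (hC x); rewrite /occupied x0; lia.
- by left; exists m; rewrite !hC; lia.
Qed.

(** * Both inclusions for the set of shadows *)

Theorem theorem5p3 (N : nat) (C : state)
    (hN : (1 < N)%N)
    (hC : clusteron C)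
    (hsize : state_size C = N)
    (hrooms : (2 <= #|` finsupp C|)%N)
    (h12 : ~ has_word C [:: 1%N; 2%N])
    (h21 : ~ has_word C [:: 2%N; 1%N]) :
  (forall b : state, reachable C b -> final b -> at_most_one_per_room b) /\
  (forall w : seq bool,
     (exists b : state, [/\ reachable C b, final b & has_shadow b w]) <->
     Ffamily N w).
Proof.
case: hC => m [n [n0 hC]].
have subC j : C j != 0%N -> j \in cells m n.
  by rewrite mem_cells -hC /occupied lt0n.
have hn : (1 < n)%N.
  apply: leq_trans hrooms _; rewrite -[n](size_iota 0) -(size_map (fun k => m + k%:Z)).
  by apply: uniq_leq_size; [exact: fset_uniq | move=> j; rewrite mem_finsupp; apply: subC].
have IC := clusteron_invariant hn hC.
split=> [b rb fb|w].
  by apply: final_at_most_one fb; case: (reachable_invariant rb IC).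
split=> [[b [rb fb sb]]|[k [hk ->]]].
  by case: (reachable_invariant rb IC) => Ib; rewrite hsize => <-; apply: final_shadow.
pose W := [seq C j | j <- cells m n].
have wordC : has_word C W.
  exists m, (m + n.-1%:Z); split; [split | split |].
  - by rewrite hC; lia.
  - by move=> i; rewrite hC; lia.
  - by rewrite hC; lia.
  - by move=> i; rewrite hC; lia.
  - by rewrite roomsE prednK.
have gW : good W.
  apply/and4P; split.
  - by apply/allP => _ /mapP [j hj ->]; rewrite mem_cells -hC in hj.
  - by rewrite !size_map size_iota.
  - by apply/eqP => e; apply: h12; rewrite -e.
  - by apply/eqP => e; apply: h21; rewrite -e.
have sW : sumn W = N.
  by rewrite -hsize (state_size_uniq (cells_uniq m n) subC) sumnE big_map.
have [|i [j [i' [j' [rF _ _ _ _]]]]] := good_solved gW (a := k.-1) (b := (N - k.+1)%N).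
  by rewrite sW; lia.
(* The window starts [i] rooms before the clusteron, so removing the padding puts [W] back at
   [m]. *)
have := reachable_state_of (m - i%:Z) rF; rewrite !state_of_pad subrK.
rewrite -state_ofP; last by move=> x /subC; rewrite mem_cells.
set F := fword _ _ => rCF; exists (state_of (m - i%:Z + i'%:Z) F); split=> //.
  exact/final_state_of/sorted_fword.
have -> : Fword N k = [seq (0 < x)%N | x <- F].
  by rewrite map_fword; congr Fword; lia.
apply: shadow_state_of; rewrite /F /fword //.
by rewrite last_cat /= last_alt.
Qed.
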